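(* Let $\mathbb N$ be a standard Poisson process on $[0,\infty)$ and let $0<\gamma\le1$ be fixed. Then $$\Pr\left(\sup_{s>0}\frac{\mathbb N(s)}{s^{1/\gamma}}\le x\right)=\begin{cases}1-1/x, & \text{if }\gamma=1,\ x\ge1,\\ 1-\sum_{k=1}^\infty a_k(x,\gamma), & \text{if }\gamma<1,\ x>0,\end{cases}$$ where the sequence $\{a_k(x,\gamma)\}_{k\ge1}$ is constructed recursively by $$a_1(x,\gamma)=p\left(\left(\tfrac1x\right)^\gamma;1\right)$$ and, for $k\ge2$, $$a_k(x,\gamma)=p\left(\left(\tfrac kx\right)^\gamma;k\right)-\sum_{i=1}^{k-1}a_i(x,\gamma)\cdot p\left(\left(\tfrac kx\right)^\gamma-\left(\tfrac ix\right)^\gamma;k-i\right),$$ with $p(m;k)\equiv e^{-m}m^k/k!$.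
   Context: A standard Poisson process has rate 1 and $\mathbb N(0)=0$. *)

(* Defs.v *)
From HB Require Import structures.
From mathcomp Require Import all_boot all_order all_algebra.
From mathcomp Require Import all_classical all_reals all_analysis.
Import Order.TTheory GRing.Theory Num.Theory.
Import numFieldNormedType.Exports.

Set Implicit Arguments.
Unset Strict Implicit.
Unset Printing Implicit Defensive.

Local Open Scope classical_set_scope.
Local Open Scope ring_scope.

(* Taking some of the [A i] to be [setT] gives the product rule for every
   subfamily, so it is enough to state it for the whole (finite) family. *)
Definition mutually_independent {R : realType} {d d' : measure_display}
    {T : measurableType d} {T' : measurableType d'} (P : probability T R)
    (n : nat) (X : 'I_n -> T -> T') : Prop :=
  forall A : 'I_n -> set T', (forall i, measurable (A i)) ->
    P (\bigcap_(i in [set: 'I_n]) (X i @^-1` A i)) =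
    (\prod_(i < n) P (X i @^-1` A i))%E.

(* The index set of the process is [0, +oo[: nothing is required of [N t] for
   [t < 0] beyond its being a random variable.  The subtraction of natural
   numbers is truncated, which is harmless because paths are nondecreasing. *)
Record standard_poisson_process {R : realType} {d : measure_display}
    {T : measurableType d} (P : probability T R)
    (N : R -> {RV P >-> nat}) : Prop := {
  spp_start : forall w, N 0 w = 0%N ;
  spp_nondecreasing : forall w s t, 0 <= s -> s <= t -> (N s w <= N t w)%N ;
  spp_right_continuous :
    forall w t, 0 <= t -> (fun s => N s w) @ t^'+ --> N t w ;
  spp_independent_increments :
    forall (n : nat) (t : nat -> R), 0 <= t 0%N ->
      (forall i, (i < n)%N -> t i < t i.+1) ->
      mutually_independent P
        (fun (i : 'I_n) w => (N (t i.+1) w - N (t i) w)%N) ;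
  spp_poisson_increments :
    forall (s t : R) (k : nat), 0 <= s -> s < t ->
      P [set w | (N t w - N s w)%N = k] = (poisson_pmf (t - s) k)%:E
}.

Definition weighted_sup {R : realType} {d : measure_display}
    {T : measurableType d} {P : probability T R}
    (N : R -> {RV P >-> nat}) (gamma : R) (w : T) : \bar R :=
  ereal_sup [set ((N s w)%:R / s `^ (1 / gamma))%:E | s in [set s : R | 0 < s]].

(* Unlike [poisson_pmf], this is given by the formula for every [m]. *)
Definition poisson_weight {R : realType} (m : R) (k : nat) : R :=
  expR (- m) * m ^+ k / k`!%:R.

Lemma poisson_weight_pmf (R : realType) (m : R) (k : nat) :
  0 < m -> poisson_weight m k = poisson_pmf m k.
Proof. by move=> m0; rewrite /poisson_weight /poisson_pmf m0 -mulrA mulrC. Qed.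

Section boundary_hitting.
Context {R : realType}.
Variables x gamma : R.

(* [n] is only fuel for the course-of-values recursion on [k]. *)
Fixpoint a_fuel (n k : nat) : R :=
  if n is n'.+1 then
    poisson_weight ((k%:R / x) `^ gamma) k -
    \sum_(1 <= i < k)
      a_fuel n' i *
      poisson_weight ((k%:R / x) `^ gamma - (i%:R / x) `^ gamma) (k - i)
  else 0.

Definition a_coef (k : nat) : R := a_fuel k k.

Lemma a_fuel_irrelevant n k : (0 < k)%N -> (k <= n)%N -> a_fuel n k = a_coef k.
Proof.
rewrite /a_coef; elim/ltn_ind: n k => -[|n] IH [|k] // _ kn.
rewrite /= /index_iota; congr (_ - _).
apply: eq_big_nat => i /andP[i0 ik]; congr (_ * _).
have ik' : (i <= k)%N by [].
by rewrite (IH n)// ?(IH k)// (leq_trans ik').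
Qed.

Lemma a_coef1E : a_coef 1 = poisson_weight ((1 / x) `^ gamma) 1.
Proof. by rewrite /a_coef /= big_geq// subr0. Qed.

Lemma a_coef_recE k : (2 <= k)%N ->
  a_coef k =
    poisson_weight ((k%:R / x) `^ gamma) k -
    \sum_(1 <= i < k)
      a_coef i *
      poisson_weight ((k%:R / x) `^ gamma - (i%:R / x) `^ gamma) (k - i).
Proof.
case: k => // k _; rewrite {1}/a_coef /=; congr (_ - _).
apply: eq_big_nat => i /andP[i0 ik].
by rewrite a_fuel_irrelevant.
Qed.

End boundary_hitting.

(* Main.v *)
Require Import Defs.
From mathcomp Require Import all_boot all_order all_algebra.
From mathcomp Require Import all_classical all_reals all_analysis.
From mathcomp Require Import ring lra.
Import Order.TTheory GRing.Theory Num.Theory.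
Import numFieldNormedType.Exports.

(** The event that the weighted supremum is at most [x] says that the path of the
    process stays under the boundary [s |-> x * s `^ (1 / gamma)], which reaches
    height [k] at the crossing time [tau k = (k / x) `^ gamma].  Since paths are
    nondecreasing and integer-valued, this only constrains them just before the
    crossing times ([weighted_sup_leP]), and since there is almost surely no jump
    at a fixed time ([no_jump_at]), the event is almost surely the intersection
    over [n] of the events [below n]: [N (tau k) < k] for [0 < k <= n].  So its
    probability is the limit of the probabilities of [below n]
    ([cvg_pr_below]).

    When [gamma < 1], compare [below n] with the event [avoid n] that
    [N (tau k) <> k] for [0 < k <= n].  A path can come back from above the
    boundary only by sitting on it at some crossing time, since between two of
    these the boundary rises by one and the path does not decrease; hence the two
    events differ only if [N (tau n) >= n] ([avoid_sub_below]), which has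
    probability tending to 0 by a Chernoff bound, as [tau n] is eventually at most
    [n / 2].  On the other hand the complement of [avoid n] is the disjoint union
    of the first hits at [k <= n], and by the Markov property the probabilities of
    the first hits satisfy the recursion that defines [a_coef]
    ([pr_first_hit]).  So the partial sums of the series are
    [1 - pr (avoid n)], which converge to one minus the probability sought.

    When [gamma = 1], the boundary is a line and the crossing times are the
    multiples of [lam = 1 / x].  The ballot theorem ([pr_below_value]) gives the
    probability of [below n] together with [N (n * lam) = m] as [1 - m / n] times
    the Poisson weight of [m]; summed over [m <= n], this is
    [P (N (n * lam) <= n) - lam * P (N (n * lam) < n)] ([pr_below]), which tends
    to [1 - lam] by the Chernoff bound if [x > 1].  The case [x = 1] follows by
    monotonicity in [x]. *)

Local Open Scope classical_set_scope.
Local Open Scope ring_scope.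

(** * Poisson weights *)

Section poisson_weights.
Context {R : realType}.
Implicit Types a b t lam : R.

Lemma poisson_weight_ge0 t k : 0 <= t -> 0 <= poisson_weight t k.
Proof. by move=> t0; rewrite divr_ge0// mulr_ge0 ?expR_ge0 ?exprn_ge0. Qed.

Lemma poisson_weightS t k :
  k.+1%:R * poisson_weight t k.+1 = t * poisson_weight t k.
Proof.
rewrite /poisson_weight factS natrM exprS; field.
by rewrite nat1r !pnatr_eq0 -!lt0n fact_gt0.
Qed.

Lemma poisson_weight_conv a b m :
  \sum_(l < m.+1) poisson_weight a l * poisson_weight b (m - l) =
  poisson_weight (a + b) m.
Proof.
rewrite /poisson_weight (addrC a b) exprDn opprD expRD !mulr_sumr mulr_suml.
apply: eq_bigr => i _; have im : (i <= m)%N by rewrite -ltnS.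
rewrite -(bin_fact im) !natrM -mulr_natr; field.
by rewrite !pnatr_eq0 -!lt0n bin_gt0 im !fact_gt0.
Qed.

(** Given that two independent Poisson variables of means [a] and [b] add up to
    [m], the first one is binomial with mean [m * a / (a + b)]; multiplied out
    so as to hold also when [a + b] is zero. *)
Lemma poisson_weight_conv_mean a b m :
  (a + b) * \sum_(l < m.+1) l%:R * (poisson_weight a l * poisson_weight b (m - l)) =
  a * m%:R * poisson_weight (a + b) m.
Proof.
case: m => [|m]; first by rewrite big_ord1 !(mulr0, mul0r).
rewrite big_ord_recl mul0r add0r.
under eq_bigr => i _ do rewrite mulrA /= /bump/= add1n subSS poisson_weightS -mulrA.
by rewrite -mulr_sumr poisson_weight_conv -[RHS]mulrA poisson_weightS; ring.
Qed.

(** The inductive step of the ballot theorem: the factor [1 - l / n] is affine in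
    [l], so averaging it over the binomial law of [l] given the total [m] only
    needs the mean of that law, which is [m * n / n.+1]. *)
Lemma ballot_conv lam n m : (0 < n)%N -> lam != 0 ->
  \sum_(l < m.+1) (1 - l%:R / n%:R) * poisson_weight (n%:R * lam) l *
                  poisson_weight lam (m - l) =
  (1 - m%:R / n.+1%:R) * poisson_weight (n.+1%:R * lam) m.
Proof.
move=> n0 lam0.
have nE : n.+1%:R * lam = n%:R * lam + lam by rewrite -addn1 natrD; ring.
have nn : n%:R != 0 :> R by rewrite pnatr_eq0 -lt0n.
have Snn : n.+1%:R != 0 :> R by rewrite pnatr_eq0.
have mean := poisson_weight_conv_mean (n%:R * lam) lam m.
rewrite (eq_bigr (fun l : 'I_m.+1 =>
    poisson_weight (n%:R * lam) l * poisson_weight lam (m - l) -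
    n%:R^-1 * (l%:R * (poisson_weight (n%:R * lam) l *
                       poisson_weight lam (m - l))))); last by move=> l _; ring.
rewrite sumrB poisson_weight_conv -mulr_sumr -nE in mean *.
rewrite mulrBl mul1r; congr (_ - _).
apply: (mulfI (mulf_neq0 Snn lam0)).
rewrite mulrCA mean; field.
by rewrite nat1r Snn nn.
Qed.

Lemma sum_exp_coeff_le t n : 0 <= t -> \sum_(k < n) t ^+ k / k`!%:R <= expR t.
Proof.
move=> t0; rewrite /expR.
have := @nondecreasing_cvgn_le _ (series (exp_coeff t)).
rewrite /series/= /exp_coeff => /(_ _ _ n); rewrite big_mkord; apply; last first.
  exact: is_cvg_series_exp_coeff.
move=> i j ij; rewrite -subr_ge0 sub_series_geq//; apply: sumr_ge0 => k _.
by rewrite exp_coeff_ge0.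
Qed.

(** Chernoff's bound: [poisson_weight t k] is tilted by [lam^-1 ^+ (k - m)], which
    is at least 1 for [k >= m], and the tilted weights sum to at most
    [lam ^+ m * expR (t / lam - t)].  The tilt [lam^-1] is the optimal one when
    [t = lam * m]. *)
Lemma sum_poisson_weight_le t m M lam : 0 <= t -> 0 < lam <= 1 ->
  t <= lam * m%:R ->
  \sum_(m <= k < M) poisson_weight t k <= (lam * expR (1 - lam)) ^+ m.
Proof.
move=> t0 /andP[lam0 lam1] tm.
have l1 : 1 <= lam^-1 by rewrite invf_ge1.
have li : 0 < lam^-1 by rewrite invr_gt0.
apply: (@le_trans _ _ (\sum_(m <= k < M)
   lam ^+ m * expR (- t) * ((t / lam) ^+ k / k`!%:R))).
  apply: ler_sum_nat => k /andP[mk _].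
  have := poisson_weight_ge0 t k t0; rewrite /poisson_weight exprMn => pk0.
  rewrite [leRHS](_ : _ = (lam ^+ m * lam^-1 ^+ k) *
    (expR (- t) * t ^+ k / k`!%:R)); last by ring.
  rewrite ler_peMl//.
  by rewrite -(subnK mk) exprD mulrCA -exprMn mulfV ?gt_eqF// expr1n mulr1 exprn_ege1.
rewrite -mulr_sumr exprMn -mulrA ler_wpM2l ?exprn_ge0 ?(ltW lam0)//.
apply: (@le_trans _ _ (expR (- t) * expR (t / lam))).
  rewrite ler_wpM2l ?expR_ge0//.
  have tl : 0 <= t / lam by rewrite divr_ge0 ?(ltW lam0).
  have [Mm|/ltnW mM] := leqP M m; first by rewrite big_geq ?expR_ge0.
  apply: le_trans (sum_exp_coeff_le (t / lam) M tl).
  rewrite -(big_mkord xpredT (fun k => (t / lam) ^+ k / k`!%:R)).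
  rewrite [leRHS](big_cat_nat _ mM)//= lerDr sumr_ge0// => k _.
  by rewrite divr_ge0// exprn_ge0.
rewrite -expRD -expRM_natl ler_expR.
rewrite (_ : - t + t / lam = t * (lam^-1 - 1)); last by ring.
apply: (@le_trans _ _ (lam * m%:R * (lam^-1 - 1))).
  by rewrite ler_wpM2r// subr_ge0.
rewrite le_eqVlt; apply/orP; left; apply/eqP; field; exact: lt0r_neq0.
Qed.

(** The complementary form of the Chernoff bound, obtained by letting the upper
    end of the tail go to infinity in the exponential series. *)
Lemma sum_poisson_weight_ge t m lam : 0 <= t -> 0 < lam <= 1 ->
  t <= lam * m%:R ->
  1 - (lam * expR (1 - lam)) ^+ m <= \sum_(k < m) poisson_weight t k.
Proof.
move=> t0 l01 tm; rewrite lerBlDr -(ler_pM2l (expR_gt0 t)) mulr1.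
apply: limr_le; first exact: is_cvg_series_exp_coeff.
near=> M; have mM : (m <= M)%N by near: M; exact: nbhs_infty_ge.
have -> : series (exp_coeff t) M = expR t * \sum_(0 <= k < M) poisson_weight t k.
  rewrite mulr_sumr; apply: eq_bigr => k _.
  by rewrite /poisson_weight !mulrA -expRD subrr expR0 mul1r.
rewrite ler_wpM2l ?expR_ge0// (big_cat_nat _ mM)//= big_mkord lerD2l.
exact: sum_poisson_weight_le.
Unshelve. all: by end_near. Qed.

Lemma chernoff_ratio_lt1 lam : 0 < lam < 1 -> 0 <= lam * expR (1 - lam) < 1.
Proof.
move=> /andP[l0 l1]; rewrite mulr_ge0 ?expR_ge0 ?(ltW l0)//=.
rewrite -[1 - lam]opprB expRN -ltr_pdivlMr ?invr_gt0 ?expR_gt0// div1r invrK.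
have := @expR_gt1Dx R (lam - 1); rewrite subr_eq0 lt_eqF//.
by rewrite addrC subrK; apply.
Qed.

End poisson_weights.

(** * Real-valued probabilities *)

Section real_valued_probability.
Context {d : measure_display} {T : measurableType d} {R : realType}.
Variable P : probability T R.
Implicit Types A B E : set T.

Definition pr A : R := fine (P A).

Lemma prE A : measurable A -> P A = (pr A)%:E.
Proof. by move=> mA; rewrite /pr fineK// fin_num_measure. Qed.

Lemma pr_ge0 A : 0 <= pr A.
Proof. by rewrite fine_ge0. Qed.

Lemma pr0 : pr set0 = 0.
Proof. by rewrite /pr measure0. Qed.

Lemma prT : pr setT = 1.
Proof. by rewrite /pr probability_setT. Qed.

Lemma prU A B : measurable A -> measurable B -> A `&` B = set0 ->
  pr (A `|` B) = pr A + pr B.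
Proof.
move=> mA mB AB; apply: EFin_inj.
by rewrite EFinD -!prE//; [exact: measureU|exact: measurableU].
Qed.

Lemma le_pr A B : measurable A -> measurable B -> A `<=` B -> pr A <= pr B.
Proof.
by move=> mA mB AB; rewrite -lee_fin -!prE// le_measure// inE.
Qed.

Lemma pr_le1 A : measurable A -> pr A <= 1.
Proof. by move=> mA; rewrite -prT le_pr. Qed.

Lemma pr_setC A : measurable A -> pr (~` A) = 1 - pr A.
Proof.
move=> mA; apply: EFin_inj.
by rewrite EFinB -!prE//; [exact: probability_setC|exact: measurableC].
Qed.

Lemma prD A B : measurable A -> measurable B -> B `<=` A ->
  pr A = pr B + pr (A `\` B).
Proof.
move=> mA mB BA; rewrite -prU//; [|exact: measurableD|by rewrite setDIK].
by rewrite setDUK.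
Qed.

Lemma pr_partition (Y : T -> nat) E l : measurable E ->
  (forall i, measurable [set w | Y w = i]) ->
  (forall w, E w -> (Y w <= l)%N) ->
  pr E = \sum_(i < l.+1) pr (E `&` [set w | Y w = i]).
Proof.
move=> mE mY Yl; apply: EFin_inj.
have mEY i : measurable (E `&` [set w | Y w = i]) by exact: measurableI.
rewrite -prE// -sumEFin.
rewrite -(big_mkord xpredT (fun i => (pr (E `&` [set w | Y w = i]))%:E)).
under eq_bigr do rewrite -prE//.
rewrite big_mkord -(@measure_bigsetU _ _ _ P (fun i => E `&` [set w | Y w = i]))//.
  congr (P _); rewrite -(bigcup_mkord l.+1 (fun i => E `&` [set w | Y w = i])).
  apply/seteqP; split=> [w Ew|w [i _ []//]].
  by exists (Y w) => //=; rewrite ltnS Yl.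
apply/trivIsetP => i j _ _ ij; apply/seteqP; split=> // w [[_ /= Yi] [_ /= Yj]].
by rewrite -Yi Yj eqxx in ij.
Qed.

End real_valued_probability.

(** * The Markov property of the Poisson process *)

Section poisson_process.
Context {R : realType} {d : measure_display} {T : measurableType d}.
Context {P : probability T R}.
Variable N : R -> {RV P >-> nat}.
Hypothesis PN : standard_poisson_process N.
Implicit Types (s : R) (t : nat -> R) (D : set nat) (Q : nat -> set nat).
Local Notation pr := (pr P).

Lemma measurable_value s D : measurable [set w | D (N s w)].
Proof. exact: (@measurable_funPTI _ _ _ _ (N s) D). Qed.

Lemma measurable_values s u (D : nat -> set nat) :
  measurable [set w | D (N s w) (N u w)].
Proof.
rewrite (_ : [set w | _] = \bigcup_k
    ([set w | N s w = k] `&` [set w | D k (N u w)])).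
  apply: bigcup_measurable => k _; apply: measurableI.
    exact: (measurable_value s [set k]).
  exact: (measurable_value u (D k)).
by apply/seteqP; split=> [w Dw|w [k _ [/= <-]]//]; exists (N s w).
Qed.

(** Index 0 is left out: the process starts deterministically, and the
    constraints of interest only concern positive indices. *)
Definition path_event (Q : nat -> set nat) (t : nat -> R) n : set T :=
  [set w | forall i, (0 < i <= n)%N -> Q i (N (t i) w)].

Lemma measurable_path_event Q t n : measurable (path_event Q t n).
Proof.
rewrite (_ : path_event Q t n = \bigcap_(i in [set i | (0 < i <= n)%N])
    [set w | Q i (N (t i) w)]).
  by apply: bigcap_measurableType => i _; exact: measurable_value.
by apply/seteqP; split=> [w Qw i /= /Qw|w Qw i /Qw].
Qed.

Lemma path_event0 Q t : path_event Q t 0 = setT.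
Proof.
apply/seteqP; split=> // w _ i; rewrite leqn0 => /andP[i0 /eqP i00].
by rewrite i00 in i0.
Qed.

Lemma path_eventS Q t n :
  path_event Q t n.+1 = path_event Q t n `&` [set w | Q n.+1 (N (t n.+1) w)].
Proof.
apply/seteqP; split=> [w Qw|w [Qw Qn] i /andP[i0]].
  split=> [i /andP[i0 iln]|]; apply: Qw; rewrite ?ltnSn// i0.
  exact: leqW.
rewrite leq_eqVlt => /predU1P[->//|iln]; by apply: Qw; rewrite i0.
Qed.

Lemma pr_value s k : 0 < s -> pr [set w | N s w = k] = poisson_weight s k.
Proof.
move=> s0; rewrite poisson_weight_pmf//; apply: EFin_inj.
rewrite -prE; last exact: (measurable_value s [set k]).
rewrite -[s in RHS]subr0 -(spp_poisson_increments PN)//.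
by congr (P _); apply/seteqP; split=> w /=; rewrite (spp_start PN) subn0.
Qed.

Definition increments_event (t : nat -> R) (a : nat -> nat) m n : set T :=
  [set w | forall i, (m <= i < n)%N -> (N (t i.+1) w - N (t i) w)%N = a i].

Lemma measurable_increments_event t a m n :
  measurable (increments_event t a m n).
Proof.
rewrite (_ : increments_event t a m n = \bigcap_(i in [set i | (m <= i < n)%N])
   [set w | (fun u v => (v - u)%N = a i) (N (t i) w) (N (t i.+1) w)]).
  apply: bigcap_measurableType => i _.
  exact: (measurable_values _ _ (fun u v => (v - u)%N = a i)).
by apply/seteqP; split=> w Ww i; exact: Ww.
Qed.

Lemma times_ge0 (t : nat -> R) n : t 0%N = 0 ->
  (forall i, (i < n)%N -> t i < t i.+1) -> forall i, (i <= n)%N -> 0 <= t i.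
Proof.
move=> t0 tlt; elim=> [|i IH] iln; first by rewrite t0.
by rewrite (le_trans (IH (ltnW iln)))// ltW// tlt.
Qed.

Lemma measurable_path_value Q t n u :
  measurable (path_event Q t n `&` [set w | N (t n) w = u]).
Proof.
apply: measurableI; first exact: measurable_path_event.
exact: (measurable_value _ [set u]).
Qed.

(** The Markov property at time [t j], in a form that can be proved by induction
    on [j]: all the increments up to time [t n] are kept in the event, so that
    the base case [j = 0] is the independence of the increments, and in the
    inductive step the value of the increment between [t j] and [t j.+1] is
    summed over. *)
Lemma pr_path_event_increments Q (t : nat -> R) n (a : nat -> nat) j l :
  t 0%N = 0 -> (forall i, (i < n)%N -> t i < t i.+1) -> (j <= n)%N ->
  pr (path_event Q t j `&` [set w | N (t j) w = l] `&`
      increments_event t a j n)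
  = pr (path_event Q t j `&` [set w | N (t j) w = l]) *
    \prod_(j <= i < n) poisson_weight (t i.+1 - t i) (a i).
Proof.
move=> t0; elim: j n a l => [|j IH] n a l tlt jn.
  rewrite path_event0 !setTI t0.
  have [->|l0] := eqVneq l 0%N; last first.
    rewrite (_ : [set w | _] = set0); first by rewrite set0I pr0 mul0r.
    apply/seteqP; split=> // w /=; rewrite (spp_start PN) => /esym/eqP.
    by rewrite (negPf l0).
  rewrite (_ : [set w | N 0 w = 0%N] = setT); last first.
    by apply/seteqP; split=> // w _ /=; exact: (spp_start PN).
  rewrite setTI prT mul1r; apply: EFin_inj.
  rewrite -prE; last exact: measurable_increments_event.
  have := spp_independent_increments PN (times_ge0 _ _ t0 tlt 0%N isT) tlt.
  move=> /(_ (fun i => [set a i])) -/(_ (fun=> I)) indep.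
  rewrite (_ : increments_event _ _ _ _ = \bigcap_(i in [set: 'I_n])
     ((fun w => (N (t i.+1) w - N (t i) w)%N) @^-1` [set a i])); last first.
    apply/seteqP; split=> w Ww.
      by move=> i _ /=; apply: Ww; exact: ltn_ord.
    by move=> i /= iln; exact: (Ww (Ordinal iln) I).
  rewrite indep big_mkord -prodEFin; apply: eq_bigr => i _.
  rewrite poisson_weight_pmf ?subr_gt0 ?tlt//.
  by rewrite -(spp_poisson_increments PN) ?tlt ?(times_ge0 _ _ t0 tlt)// ltnW.
(* The increment over the last step of the path joins the increments to come. *)
have step n' b : (forall i, (i < n')%N -> t i < t i.+1) -> (j < n')%N ->
   pr (path_event Q t j.+1 `&` [set w | N (t j.+1) w = l] `&`
       increments_event t b j.+1 n')
   = (\sum_(k < l.+1) `[< Q j.+1 l >]%:R * (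
      pr (path_event Q t j `&` [set w | N (t j) w = k]) *
      poisson_weight (t j.+1 - t j) (l - k))) *
      \prod_(j.+1 <= i < n') poisson_weight (t i.+1 - t i) (b i).
  move=> {a jn tlt}tlt jn.
  have N_le w : (N (t j) w <= N (t j.+1) w)%N.
    apply: (spp_nondecreasing PN); last by rewrite ltW ?tlt.
    by rewrite (times_ge0 _ _ t0 tlt)// ltnW.
  rewrite (pr_partition P (N (t j)) _ l); last 3 first.
  - apply: measurableI; first exact: measurable_path_value.
    exact: measurable_increments_event.
  - by move=> k; exact: (measurable_value _ [set k]).
  - by move=> w [[_ /= <-] _]; exact: N_le.
  rewrite mulr_suml; apply: eq_bigr => k _.
  have [Ql|nQl] := asboolP (Q j.+1 l); last first.
    rewrite mul0r mul0r (_ : _ `&` _ = set0) ?pr0//.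
    apply/seteqP; split=> // w [[[+ /= Nl] _] _].
    by rewrite path_eventS => -[_ /=]; rewrite Nl.
  rewrite mul1r.
  have /= := IH n' (fun i => if i == j then (l - k)%N else b i) k tlt (ltnW jn).
  rewrite (big_ltn jn) eqxx.
  rewrite (eq_big_nat _ _
    (F2 := fun i => poisson_weight (t i.+1 - t i) (b i))); last first.
    by move=> i /andP[ji _]; rewrite gtn_eqF.
  rewrite mulrA => <-; congr pr; apply/seteqP; split.
    move=> w [[[+ /= Nl] Wb] /= Nk]; rewrite path_eventS => -[Gw _].
    split=> // i; have [->|ij] := eqVneq i j; first by rewrite Nl Nk.
    move=> /andP[ji iln]; apply: Wb; rewrite iln andbT.
    by rewrite ltn_neqAle eq_sym ij.
  move=> w [[Gw /= Nk] Wb].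
  have Nl : N (t j.+1) w = l.
    have := Wb j; rewrite leqnn jn eqxx => /(_ isT) jl.
    rewrite -(subnK (N_le w)) jl Nk subnK//.
    by rewrite -ltnS.
  split=> //; split=> [|i /andP[ji iln]].
    by split=> //; rewrite path_eventS; split=> //=; rewrite Nl.
  have := Wb i; rewrite iln (ltnW ji) => /(_ isT) ->.
  by rewrite gtn_eqF.
rewrite step//; congr (_ * _).
(* With no increments left to come, the same formula gives the first factor. *)
have tltj i : (i < j.+1)%N -> t i < t i.+1.
  by move=> ij; apply: tlt; exact: leq_trans ij jn.
have := step j.+1 a tltj (ltnSn j); rewrite big_geq// mulr1 => <-.
congr pr; rewrite [X in _ `&` X](_ : _ = setT) ?setIT//.
by apply/seteqP; split=> // w _ i; rewrite leqNgt andNb.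
Qed.
End poisson_process.

(** * First hits and the ballot theorem *)

Section poisson_paths.
Context {R : realType} {d : measure_display} {T : measurableType d}.
Context {P : probability T R}.
Variable N : R -> {RV P >-> nat}.
Hypothesis PN : standard_poisson_process N.
Implicit Types (s : R) (t : nat -> R) (D : set nat) (Q : nat -> set nat).
Local Notation pr := (pr P).
Local Notation path_event := (path_event N).

Lemma eq_path_event Q Q' t t' n :
  (forall i, (0 < i <= n)%N -> Q i = Q' i /\ t i = t' i) ->
  path_event Q t n = path_event Q' t' n.
Proof.
move=> eqQt; apply/seteqP; split=> w Qw i i0n; have [QQ' tt'] := eqQt i i0n.
  by rewrite -QQ' -tt'; exact: Qw.
by rewrite QQ' tt'; exact: Qw.
Qed.

(** The simple Markov property: given the value at time [t n], the increment up to
    a later time [s] forgets the path. *)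
Lemma pr_path_event_value Q t n l s m :
  t 0%N = 0 -> (forall i, (i < n)%N -> t i < t i.+1) -> t n < s -> (l <= m)%N ->
  pr (path_event Q t n `&` [set w | N (t n) w = l] `&` [set w | N s w = m]) =
  pr (path_event Q t n `&` [set w | N (t n) w = l]) *
  poisson_weight (s - t n) (m - l).
Proof.
move=> t0 tlt tns lm.
pose t' i := if (i <= n)%N then t i else s.
have t'n : t' n = t n by rewrite /t' leqnn.
have t'Sn : t' n.+1 = s by rewrite /t' ltnn.
have t'lt i : (i < n.+1)%N -> t' i < t' i.+1.
  rewrite ltnS leq_eqVlt => /predU1P[->|iln]; first by rewrite t'n t'Sn.
  by rewrite /t' (ltnW iln) iln tlt.
have <- : path_event Q t' n = path_event Q t n.
  by apply: eq_path_event => i /andP[_ iln]; rewrite /t' iln.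
have := pr_path_event_increments N PN Q t' n.+1 (fun=> (m - l)%N) n l t0 t'lt (leqnSn n).
rewrite big_nat1 t'n t'Sn => <-; congr pr.
apply/seteqP; split=> w [[Qw Nl]] => [Nm|/(_ n)].
  split=> // i /andP[ni iln]; have -> : i = n by apply/eqP; rewrite eqn_leq ni andbT.
  by rewrite t'n t'Sn /= in Nl Nm *; rewrite Nl Nm.
rewrite leqnn ltnSn t'n t'Sn => /(_ isT) /= Nml; split=> //=.
rewrite /= in Nl.
have Nle : (N (t n) w <= N s w)%N.
  apply: (spp_nondecreasing PN); last exact: ltW.
  exact: (times_ge0 _ _ t0 tlt).
by rewrite -(subnK Nle) Nml Nl subnK.
Qed.

Lemma pr_lt s m : 0 < s -> pr [set w | (N s w < m)%N] =
  \sum_(k < m) poisson_weight s k.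
Proof.
move=> s0; case: m => [|m].
  by rewrite big_ord0 (_ : [set w | _] = set0) ?pr0//; apply/seteqP; split.
have mV k : measurable [set w | N s w = k] by exact: (measurable_value N s [set k]).
rewrite (pr_partition P (N s) _ m)//; last first.
  exact: (measurable_value N s [set k | (k < m.+1)%N]).
apply: eq_bigr => k _; rewrite -(pr_value N PN)//; congr pr.
by apply/seteqP; split=> [w []//|w /= Nk]; split=> //=; rewrite Nk.
Qed.

Lemma pr_ge s m : 0 < s -> pr [set w | (m <= N s w)%N] =
  1 - \sum_(k < m) poisson_weight s k.
Proof.
move=> s0; rewrite -pr_lt// -pr_setC; last first.
  exact: (measurable_value N s [set k | (k < m)%N]).
congr pr; apply/seteqP; split=> w /=; first by rewrite leqNgt => /negP.
by move/negP; rewrite -leqNgt.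
Qed.

(** The times [t i] are those at which a boundary reaches the height [i]. *)
Section first_hit.
Variable t : nat -> R.
Hypothesis t0 : t 0%N = 0.
Hypothesis tlt : forall i, t i < t i.+1.

Lemma time_lt i j : (i < j)%N -> t i < t j.
Proof.
elim: j => // j IH; rewrite ltnS leq_eqVlt => /predU1P[->//|/IH ij].
exact: lt_trans ij (tlt j).
Qed.

Lemma time_gt0 i : (0 < i)%N -> 0 < t i.
Proof. by move=> i0; rewrite -t0 time_lt. Qed.

Definition avoid := path_event (fun i => [set v | v <> i]) t.
Definition below := path_event (fun i => [set v | (v < i)%N]) t.
Definition first_hit k := avoid k.-1 `&` [set w | N (t k) w = k].

Lemma measurable_first_hit k : measurable (first_hit k).
Proof.
apply: measurableI; first exact: measurable_path_event.
exact: (measurable_value N _ [set k]).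
Qed.

(** Decomposition of [A] according to the first hit, if any, among the first [n]
    indices.  With [A] the event of a hit at [n] it yields the recursion for the
    first-hit law; with [A] the sure event it yields the partial sums. *)
Lemma sum_first_hit A n : measurable A ->
  \sum_(1 <= i < n.+1) pr (first_hit i `&` A) = pr A - pr (avoid n `&` A).
Proof.
move=> mA; elim: n => [|n IH].
  by rewrite big_geq// /avoid path_event0 setTI subrr.
have mavoid m : measurable (avoid m `&` A).
  by apply: measurableI => //; exact: measurable_path_event.
rewrite big_nat_recr//= IH.
suff -> : pr (avoid n `&` A) = pr (avoid n.+1 `&` A) + pr (first_hit n.+1 `&` A) by ring.
rewrite -prU//; last 2 first.
- by apply: measurableI => //; exact: measurable_first_hit.
- apply/seteqP; split=> // w [[/(_ n.+1) Aw _] [[_ hit] _]].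
  by apply: Aw => //; rewrite ltnSn.
congr pr; rewrite /first_hit /avoid path_eventS /=; apply/seteqP; split=> w /=.
  by move=> [Aw ?]; have [E|E] := pselect (N (t n.+1) w = n.+1); [right|left].
by move=> [[[]]|[[]]].
Qed.

Lemma pr_first_hit_value i k : (0 < i < k)%N ->
  pr (first_hit i `&` [set w | N (t k) w = k]) =
  pr (first_hit i) * poisson_weight (t k - t i) (k - i).
Proof.
case: i => // i /= ik.
pose Q j := [set v : nat | (j <= i)%N -> v <> j].
have -> : first_hit i.+1 = path_event Q t i.+1 `&` [set w | N (t i.+1) w = i.+1].
  rewrite path_eventS -setIA; congr (_ `&` _).
    apply: eq_path_event => j /andP[_ ji]; split=> //.
    by apply/seteqP; split=> v /=; rewrite /Q /= ji //; exact.
  apply/seteqP; split=> [w Nw|w []//]; split=> //; by rewrite /Q /= ltnn.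
by rewrite pr_path_event_value ?time_lt// ltnW.
Qed.

(** The renewal-type recursion that defines the coefficients [a_coef]. *)
Lemma pr_first_hit k : (0 < k)%N ->
  pr (first_hit k) = poisson_weight (t k) k -
    \sum_(1 <= i < k) pr (first_hit i) * poisson_weight (t k - t i) (k - i).
Proof.
case: k => // k _.
have mV : measurable [set w | N (t k.+1) w = k.+1].
  exact: (measurable_value N _ [set k.+1]).
have := sum_first_hit [set w | N (t k.+1) w = k.+1] k mV.
rewrite (pr_value N PN) ?time_gt0// => E.
rewrite -[pr (first_hit _)](subKr (poisson_weight (t k.+1) k.+1)) -E.
congr (_ - _); apply: eq_big_nat => i i1k.
by rewrite pr_first_hit_value.
Qed.

Lemma sum_pr_first_hit n :
  \sum_(1 <= i < n.+1) pr (first_hit i) = 1 - pr (avoid n).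
Proof.
have := sum_first_hit setT n measurableT; rewrite prT setIT => <-.
by apply: eq_bigr => i _; rewrite setIT.
Qed.

Lemma below_sub_avoid n : below n `<=` avoid n.
Proof. by move=> w Bw i /Bw /= Ni iE; rewrite iE ltnn in Ni. Qed.

(** Staying off the boundary differs from staying below it only if the path is
    late above it: paths are nondecreasing and the boundary rises by one between
    [t j] and [t j.+1], so a path that reaches it and never sits on it cannot
    come back under it. *)
Lemma avoid_sub_below n : (0 < n)%N ->
  avoid n `<=` below n `|` [set w | (n <= N (t n) w)%N].
Proof.
move=> n0 w Aw; have [|nB] := pselect (below n w); [by left|right=> /=].
have [i [/andP[i0 iln] Ni]] : exists i, (0 < i <= n)%N /\ (i <= N (t i) w)%N.
  apply: contrapT => nE; apply: nB => i i0n /=; rewrite ltnNge; apply/negP => Ni.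
  by apply: nE; exists i.
suff : forall j, (i <= j <= n)%N -> (j <= N (t j) w)%N by apply; rewrite iln leqnn.
elim=> [|j IH] //; rewrite leq_eqVlt => /andP[/predU1P[<-//|ij] jn].
have Nj : (j < N (t j) w)%N.
  rewrite ltn_neqAle IH ?(ltnW jn) ?andbT; last by rewrite -ltnS.
  apply/eqP => /esym; apply: Aw; rewrite (ltnW jn) andbT.
  by rewrite (leq_trans i0).
apply: leq_trans Nj _; apply: (spp_nondecreasing PN); last exact: ltW.
by apply/ltW/time_gt0; rewrite (leq_trans i0).
Qed.

Lemma pr_avoid_le n : (0 < n)%N ->
  pr (below n) <= pr (avoid n) <= pr (below n) + pr [set w | (n <= N (t n) w)%N].
Proof.
move=> n0.
have mB : measurable (below n) by exact: measurable_path_event.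
have mA : measurable (avoid n) by exact: measurable_path_event.
have mG : measurable [set w | (n <= N (t n) w)%N].
  exact: (measurable_value N _ [set k | (n <= k)%N]).
rewrite le_pr//=; last exact: below_sub_avoid.
rewrite -lerBlDl.
have mD : measurable (avoid n `\` below n) by exact: measurableD.
rewrite (prD _ _ _ mA mB); last exact: below_sub_avoid.
rewrite addrAC subrr add0r le_pr// => w [/(avoid_sub_below _ n0) [//|//]].
Qed.

End first_hit.

(** The ballot theorem for the Poisson process: given [m] points before time
    [n * lam], the path stays below the line with probability [1 - m / n].  Both
    sides satisfy the same one-step recursion; the factor vanishes at [m = n],
    where the last constraint fails, so the step from [n] to [n.+1] never needs
    a value [m > n]. *)
Lemma pr_below_value lam n m : 0 < lam -> (0 < n)%N -> (m <= n)%N ->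
  pr (below (fun i => i%:R * lam) n `&` [set w | N (n%:R * lam) w = m]) =
  (1 - m%:R / n%:R) * poisson_weight (n%:R * lam) m.
Proof.
move=> l0; set t := fun i : nat => i%:R * lam.
have t0 : t 0%N = 0 by rewrite /t mul0r.
have tlt i : t i < t i.+1 by rewrite /t ltr_pM2r// ltr_nat.
have mV s k : measurable [set w | N s w = k] by exact: (measurable_value N s [set k]).
elim: n m => // n IH m _.
rewrite leq_eqVlt => /predU1P[->|mn].
  rewrite divff ?pnatr_eq0// subrr mul0r (_ : _ `&` _ = set0) ?pr0//.
  apply/seteqP; split=> // w [/(_ n.+1) + /= Nm].
  by rewrite leqnn /= Nm ltnn => /(_ isT).
rewrite (_ : _ `&` _ = below t n `&` [set w | N (n.+1%:R * lam) w = m]); last first.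
  rewrite /below path_eventS; apply/seteqP; split=> w /=.
    by move=> [[Bw _] Nm].
  by move=> [Bw Nm]; split=> //; split=> //; rewrite Nm.
have [n0|n0] := posnP n.
  move: mn; rewrite n0 ltnS leqn0 => /eqP ->.
  rewrite mul0r subr0 mul1r -(pr_value N PN) ?mulr_gt0//.
  by rewrite /below path_event0 setTI.
rewrite (pr_partition P (N (n%:R * lam)) _ m)//; last 2 first.
- by apply: measurableI => //; exact: measurable_path_event.
- move=> w [_ /= <-]; apply: (spp_nondecreasing PN).
    by rewrite mulr_ge0// ltW.
  exact: ltW (tlt n).
rewrite -ballot_conv ?gt_eqF//; apply: eq_bigr => l _.
have lm : (l <= m)%N by rewrite -ltnS.
rewrite setIAC (pr_path_event_value _ t)//.
rewrite IH//; last exact: leq_trans lm _.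
congr (_ * poisson_weight _ _).
by rewrite /t -mulrBl -natrB// subSnn mul1r.
Qed.

(** The ballot probabilities summed over the last value, using that
    [m / n * p m = lam * p m.-1] for the weights [p] of mean [n * lam]. *)
Lemma pr_below lam n : 0 < lam -> (0 < n)%N ->
  pr (below (fun i => i%:R * lam) n) =
  (\sum_(m < n.+1) poisson_weight (n%:R * lam) m) -
  lam * \sum_(m < n) poisson_weight (n%:R * lam) m.
Proof.
move=> l0 n0.
have mV s k : measurable [set w | N s w = k] by exact: (measurable_value N s [set k]).
rewrite (pr_partition P (N (n%:R * lam)) _ n)//; last 2 first.
- exact: measurable_path_event.
- by move=> w /(_ n); rewrite n0 leqnn /= => /(_ isT)/ltnW.
rewrite (eq_bigr (fun m : 'I_n.+1 => poisson_weight (n%:R * lam) m -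
    m%:R / n%:R * poisson_weight (n%:R * lam) m)); last first.
  move=> m _; rewrite pr_below_value//; last by rewrite -ltnS.
  by rewrite mulrBl mul1r.
rewrite sumrB; congr (_ - _).
rewrite big_ord_recl !mul0r add0r mulr_sumr; apply: eq_bigr => m _.
rewrite mulrAC /= /bump/= add1n poisson_weightS; field.
by rewrite pnatr_eq0 -lt0n.
Qed.

End poisson_paths.

(** * Crossing times of the boundary *)

Section boundary.
Context {R : realType}.
Variables x gamma : R.
Hypothesis x0 : 0 < x.
Hypothesis gamma0 : 0 < gamma.

Definition crossing_time (k : nat) : R := (k%:R / x) `^ gamma.
Local Notation tau := crossing_time.

Lemma crossing_time0 : tau 0 = 0.
Proof. by rewrite /tau mul0r powR0// gt_eqF. Qed.

Lemma crossing_time_lt k : tau k < tau k.+1.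
Proof.
rewrite /tau gt0_ltr_powR// ?nnegrE ?divr_ge0// ?(ltW x0)//.
by rewrite ltr_pM2r ?invr_gt0// ltr_nat.
Qed.

Lemma lt_crossing_time s k : 0 < s ->
  (s < tau k) = (x * s `^ (1 / gamma) < k%:R).
Proof.
move=> s0; have kx : 0 <= k%:R / x by rewrite divr_ge0 ?(ltW x0).
rewrite mulrC -ltr_pdivlMr// div1r.
have gi : 0 < gamma^-1 by rewrite invr_gt0.
apply/idP/idP => [|lt].
  move=> /(gt0_ltr_powR gi); rewrite !nnegrE powR_ge0 (ltW s0) => /(_ isT isT).
  by rewrite /tau -powRrM mulfV ?gt_eqF// powRr1.
rewrite -(@powRr1 _ s) ?(ltW s0)// -(@mulVf _ gamma) ?gt_eqF// powRrM.
by rewrite /tau gt0_ltr_powR// nnegrE ?powR_ge0.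
Qed.

(** The boundary [x * s `^ (1 / gamma)] is superlinear, so its crossing times are
    eventually below those of any line; slope 2 is enough to stay strictly
    above the unit drift of the process. *)
Lemma near_crossing_time_le (gamma1 : gamma < 1) :
  \forall n \near \oo, tau n <= 2^-1 * n%:R.
Proof.
have g1 : 0 < 1 - gamma by rewrite subr_gt0.
near=> n.
have n0 : 0 < n%:R :> R by rewrite ltr0n; near: n; exact: nbhs_infty_gt.
have big : (2 * x^-1 `^ gamma) `^ (1 - gamma)^-1 <= n%:R.
  by near: n; exact: nbhs_infty_ger.
rewrite /tau powRM ?invr_ge0 ?(ltW x0)//.
have nE : n%:R = n%:R `^ gamma * n%:R `^ (1 - gamma) :> R.
  rewrite -powRD; last by rewrite (gt_eqF n0) implybT.
  by rewrite addrC subrK powRr1// ltW.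
rewrite [X in _ <= _ * X]nE mulrCA ler_wpM2l ?powR_ge0//.
rewrite ler_pdivlMl//.
move: big => /(ge0_ler_powR (ltW g1)).
rewrite !nnegrE powR_ge0 (ltW n0) => /(_ isT isT).
by rewrite -powRrM mulVf ?gt_eqF// powRr1// mulr_ge0 ?powR_ge0.
Unshelve. all: by end_near. Qed.

(** An explicit sequence increasing to [t], by which conditions at all times
    before [t] become countable. *)
Definition before (t : R) (n : nat) : R := t * (1 - n.+2%:R^-1).

Lemma before_itv t n : 0 < t -> 0 < before t n < t.
Proof.
move=> t0; have n2 : n.+2%:R^-1 < 1 :> R by rewrite invf_lt1 ?ltr1n.
by rewrite mulr_gt0 ?subr_gt0//= gtr_pMr// gtrBl invr_gt0.
Qed.

Lemma lt_before t s : 0 < t -> s < t -> exists n, s <= before t n.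
Proof.
move=> t0 st.
have [n nP] : exists n : nat, t / (t - s) < n.+2%:R.
  exists (Num.truncn (t / (t - s))); apply: lt_trans (truncnS_gt _) _.
  by rewrite ltr_nat.
exists n; rewrite /before mulrBr mulr1 lerBrDr -lerBrDl.
rewrite ler_pdivrMr// mulrC -ler_pdivrMr ?subr_gt0//.
exact: ltW.
Qed.

End boundary.

(** * The law of the weighted supremum *)

Section weighted_supremum.
Context {R : realType} {d : measure_display} {T : measurableType d}.
Context {P : probability T R}.
Variable N : R -> {RV P >-> nat}.
Hypothesis PN : standard_poisson_process N.
Local Notation pr := (pr P).

(** As long as [s] lies between the crossing times of heights [k] and [k.+1], the
    boundary lies between [k] and [k.+1], so an integer-valued path is under it
    exactly when its value is at most [k]; by monotonicity only the times just
    before the crossing of [k.+1] matter. *)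
Lemma weighted_sup_leP x gamma w : 0 < x -> 0 < gamma ->
  (weighted_sup N gamma w <= x%:E)%E <->
  forall k n, (N (before (crossing_time x gamma k.+1) n) w <= k)%N.
Proof.
move=> x0 g0.
have tau0 k : 0 < crossing_time x gamma k.+1.
  by rewrite powR_gt0// divr_gt0.
have leE s : 0 < s -> (((N s w)%:R / s `^ (1 / gamma))%:E <= x%:E)%E =
    ((N s w)%:R <= x * s `^ (1 / gamma)).
  by move=> s0; rewrite lee_fin ler_pdivrMr ?powR_gt0.
split=> [Sx k n|Nk].
  have /andP[u0 ut] := before_itv _ n (tau0 k).
  rewrite -ltnS -(ltr_nat R); move: ut; rewrite lt_crossing_time//.
  apply: le_lt_trans; rewrite -leE//; apply: le_trans Sx.
  by apply: ereal_sup_ubound; exists (before (crossing_time x gamma k.+1) n).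
apply: ge_ereal_sup => _ [s /= s0 <-]; rewrite leE//.
set y := x * _; have y0 : 0 <= y by rewrite mulr_ge0 ?powR_ge0// ltW.
have /andP[ly yl] := truncn_itv y0.
apply: le_trans ly; rewrite ler_nat.
move: yl; rewrite -lt_crossing_time// => /(lt_before _ _ (tau0 _))[n sn].
apply: leq_trans (Nk _ n); apply: (spp_nondecreasing PN) => //.
exact: ltW.
Qed.

Lemma measurable_weighted_sup x gamma : 0 < x -> 0 < gamma ->
  measurable [set w | (weighted_sup N gamma w <= x%:E)%E].
Proof.
move=> x0 g0.
rewrite (_ : [set w | _] = \bigcap_k \bigcap_n
    [set w | (N (before (crossing_time x gamma k.+1) n) w <= k)%N]).
  apply: bigcap_measurableType => k _; apply: bigcap_measurableType => n _.
  exact: (measurable_value N _ [set v | (v <= k)%N]).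
apply/seteqP; split=> w /=; first by move=> /weighted_sup_leP H k _ n _; exact: H.
by move=> H; apply/weighted_sup_leP => // k n; exact: H.
Qed.

Lemma pr_incrementime_gt0_le (s t : R) : 0 <= s -> s < t ->
  pr [set w | (N s w < N t w)%N] <= t - s.
Proof.
move=> s0 st.
have m0 : measurable [set w | (N t w - N s w)%N = 0%N].
  exact: (measurable_values N s t (fun u v => (v - u)%N = 0%N)).
rewrite (_ : [set w | _] = ~` [set w | (N t w - N s w)%N = 0%N]); last first.
  apply/seteqP; split=> w /=; first by rewrite -subn_gt0 lt0n => /eqP.
  by move/eqP; rewrite -lt0n subn_gt0.
rewrite pr_setC// {1}/pr (spp_poisson_increments PN)//=.
rewrite -poisson_weight_pmf ?subr_gt0// /poisson_weight expr0 mulr1 divr1.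
by have := expR_ge1Dx (- (t - s)); lra.
Qed.

(** Almost surely there is no jump at a given time: a jump at [t] forces an
    increment over every interval ending at [t], however short. *)
Lemma no_jump_at (t : R) k : 0 < t ->
  P.-negligible ([set w | (k < N t w)%N] `&`
                 [set w | forall n, (N (before t n) w <= k)%N]).
Proof.
move=> t0; set J := _ `&` _.
have mJ : measurable J.
  apply: measurableI; first exact: (measurable_value N _ [set v | (k < v)%N]).
  rewrite (_ : [set w | _] = \bigcap_n [set w | (N (before t n) w <= k)%N]).
    apply: bigcap_measurableType => n _.
    exact: (measurable_value N _ [set v | (v <= k)%N]).
  by apply/seteqP; split=> [w H n _|w H n]; exact: H.
apply: (proj2 (negligibleP P mJ)).
transitivity (pr J)%:E; [exact: prE|congr (_%:E)].
apply/eqP; rewrite eq_le pr_ge0 andbT; apply/ler_addgt0Pl => e e0; rewrite addr0.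
have te : t - e < t by rewrite gtrBl.
have [n nP] := lt_before _ _ t0 te.
have /andP[u0 ut] := before_itv _ n t0.
apply: (@le_trans _ _ (t - before t n)); last by rewrite lerBlDr -lerBlDl.
apply: le_trans (pr_incrementime_gt0_le _ _ (ltW u0) ut).
apply: le_pr => //.
  exact: (measurable_values N _ _ (fun u v => (u < v)%N)).
by move=> w [/= kN Nk]; exact: leq_ltn_trans (Nk n) kN.
Qed.

(** Up to a jump exactly at a crossing time, the left-limit conditions of
    [weighted_sup_leP] are conditions on the values at the crossing times. *)
Lemma cvg_pr_below x gamma : 0 < x -> 0 < gamma ->
  pr (below N (crossing_time x gamma) n) @[n --> \oo] -->
  pr [set w | (weighted_sup N gamma w <= x%:E)%E].
Proof.
move=> x0 g0; set E := [set w | _]; set tau := crossing_time x gamma.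
have mE : measurable E by exact: measurable_weighted_sup.
have mB n : measurable (below N tau n) by exact: measurable_path_event.
have mBB : measurable (\bigcap_n below N tau n) by exact: bigcap_measurableType.
have tau0 k : 0 < tau k.+1 by rewrite powR_gt0// divr_gt0.
have BE : \bigcap_n below N tau n `<=` E.
  move=> w Bw; apply/weighted_sup_leP => // k n.
  have /andP[u0 ut] := before_itv _ n (tau0 k).
  apply: leq_trans (_ : (N (tau k.+1) w <= k)%N).
    by apply: (spp_nondecreasing PN); exact: ltW.
  by have := Bw k.+1 I k.+1; rewrite leqnn => /(_ isT).
have EB : pr (E `\` \bigcap_n below N tau n) = 0.
  apply: EFin_inj; rewrite -prE; last exact: measurableD.
  apply: measure_negligible; first exact: measurableD.
  apply: negligibleS (negligible_bigcup (fun k => no_jump_at _ k (tau0 k))).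
  move=> w [Ew nB]; apply: contrapT => nJ; apply: nB => n _ i /andP[i0 _] /=.
  rewrite ltnNge; apply/negP => iN; apply: nJ; exists i.-1 => //.
  rewrite /= prednK//; split=> // m.
  have := proj1 (weighted_sup_leP x gamma w x0 g0) Ew i.-1 m.
  by rewrite prednK.
have -> : pr E = pr (\bigcap_n below N tau n).
  by rewrite (prD P E _ mE mBB BE) EB addr0.
apply: fine_cvg; rewrite -prE//.
apply: nonincreasing_cvg_mu => //; first by rewrite -ge0_fin_numE// fin_num_measure.
move=> m n mn; apply/subsetPset => w Bw i /andP[i0 im].
by apply: Bw; rewrite i0 (leq_trans im).
Qed.

Lemma pr_ge_le (lam s : R) n : 0 < lam < 1 -> 0 < s <= lam * n%:R ->
  pr [set w | (n <= N s w)%N] <= (lam * expR (1 - lam)) ^+ n.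
Proof.
move=> /andP[l0 l1] /andP[s0 sn]; rewrite (pr_ge N PN)// lerBlDr -lerBlDl.
by rewrite sum_poisson_weight_ge ?(ltW s0)// l0 ltW.
Qed.

Lemma cvg_chernoff (lam : R) : 0 < lam < 1 ->
  (lam * expR (1 - lam)) ^+ n @[n --> \oo] --> 0.
Proof.
by move=> /chernoff_ratio_lt1/andP[r0 r1]; apply: cvg_expr; rewrite ger0_norm.
Qed.

(** The shift [e] covers both sums of [pr_below]. *)
Lemma cvg_sum_poisson_weight (lam : R) (e : nat) : 0 < lam < 1 ->
  \sum_(m < n + e) poisson_weight (n%:R * lam) m @[n --> \oo] --> (1 : R).
Proof.
move=> l01; have /andP[l0 l1] := l01.
apply: (@squeeze_cvgr _ _ _ _ (fun n => 1 - (lam * expR (1 - lam)) ^+ n) (fun=> 1)).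
- near=> n; have n0 : (0 < n)%N by near: n; exact: nbhs_infty_gt.
  have s0 : 0 < n%:R * lam by rewrite mulr_gt0 ?ltr0n.
  apply/andP; split.
    apply: (@le_trans _ _ (\sum_(m < n) poisson_weight (n%:R * lam) m)).
      by apply: sum_poisson_weight_ge; rewrite ?(ltW s0) ?l0 ?(ltW l1)// mulrC.
    rewrite -!(big_mkord xpredT (poisson_weight (n%:R * lam))).
    rewrite [leRHS](big_cat_nat _ (leq_addr e n))//= lerDl.
    by apply: sumr_ge0 => k _; rewrite poisson_weight_ge0// ltW.
  rewrite -(pr_lt N PN)// pr_le1//.
  exact: (measurable_value N _ [set k | (k < n + e)%N]).
- rewrite -[X in _ --> X]subr0; apply: cvgB; first exact: cvg_cst.
  exact: cvg_chernoff.
- exact: cvg_cst.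
Unshelve. all: by end_near. Qed.

Lemma pr_weighted_sup_linear x : 1 < x ->
  pr [set w | (weighted_sup N 1 w <= x%:E)%E] = 1 - 1 / x.
Proof.
move=> x1; have x0 : 0 < x by rewrite (lt_trans _ x1).
have l01 : 0 < x^-1 < 1 by rewrite invr_gt0 x0 invf_lt1.
have tauE : crossing_time x 1 = (fun i => i%:R * x^-1).
  by apply/funext => i; rewrite /crossing_time powRr1// divr_ge0// ltW.
have := cvg_pr_below x 1 x0 ltr01; rewrite tauE => cvgE.
apply: (cvg_unique _ cvgE) => //.
apply: (@cvg_trans _ ((\sum_(m < n + 1) poisson_weight (n%:R * x^-1) m -
   x^-1 * \sum_(m < n + 0) poisson_weight (n%:R * x^-1) m) @[n --> \oo])).
  apply: near_eq_cvg; near=> n; have n0 : (0 < n)%N by near: n; exact: nbhs_infty_gt.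
  by rewrite (pr_below N PN) ?invr_gt0// addn1 addn0.
rewrite [1 / x]mul1r -[X in 1 - X]mulr1.
apply: cvgB; first exact: cvg_sum_poisson_weight.
by apply: cvgMr; exact: cvg_sum_poisson_weight.
Unshelve. all: by end_near. Qed.

(** At [x = 1] the drift of the process equals the slope of the line and the tail
    bound degenerates; the value is squeezed from slopes above 1. *)
Lemma pr_weighted_sup_linear1 :
  pr [set w | (weighted_sup N 1 w <= 1%:E)%E] = 0.
Proof.
apply/eqP; rewrite eq_le pr_ge0 andbT; apply/ler_addgt0Pl => e e0; rewrite addr0.
have e1 : 1 < 1 + e by rewrite ltrDl.
apply: (@le_trans _ _ (1 - 1 / (1 + e))).
  rewrite -pr_weighted_sup_linear// le_pr//.
  - by apply: measurable_weighted_sup.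
  - by apply: measurable_weighted_sup => //; rewrite (lt_trans _ e1).
  - by move=> w /= /le_trans; apply; rewrite lee_fin ltW.
rewrite lerBlDr -lerBlDl ler_pdivlMr ?(lt_trans _ e1)//.
nra.
Qed.

Lemma pr_first_hit_a_coef x gamma k : 0 < x -> 0 < gamma -> (0 < k)%N ->
  pr (first_hit N (crossing_time x gamma) k) = a_coef x gamma k.
Proof.
move=> x0 g0; have t0 := crossing_time0 x gamma g0.
have tlt := crossing_time_lt x gamma x0 g0.
elim/ltn_ind: k => k IH k0; rewrite (pr_first_hit N PN _ t0 tlt)//.
have [k1|k1] := leqP 2 k; last first.
  have -> : k = 1%N by apply/eqP; rewrite eqn_leq -ltnS k1.
  by rewrite big_geq// subr0 a_coef1E.
rewrite a_coef_recE//; congr (_ - _); apply: eq_big_nat => i /andP[i0 ik].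
by rewrite IH.
Qed.

Lemma cvg_pr_avoid x gamma : 0 < x -> 0 < gamma -> gamma < 1 ->
  pr (avoid N (crossing_time x gamma) n) @[n --> \oo] -->
  pr [set w | (weighted_sup N gamma w <= x%:E)%E].
Proof.
move=> x0 g0 g1; have t0 := crossing_time0 x gamma g0.
have tlt := crossing_time_lt x gamma x0 g0.
have cvg_below := cvg_pr_below x gamma x0 g0.
have half01 : 0 < (2^-1 : R) < 1 by rewrite invr_gt0 ltr0n invf_lt1 ?ltr1n.
apply: (@squeeze_cvgr _ _ _ _ (fun n => pr (below N (crossing_time x gamma) n))
  (fun n => pr (below N (crossing_time x gamma) n) +
            (2^-1 * expR (1 - 2^-1)) ^+ n)) => //; last first.
  rewrite -[X in _ --> X]addr0; apply: cvgD => //; exact: cvg_chernoff.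
near=> n; have n0 : (0 < n)%N by near: n; exact: nbhs_infty_gt.
have /andP[-> /le_trans->//] := pr_avoid_le N PN _ t0 tlt n n0.
rewrite lerD2l pr_ge_le// (time_gt0 _ t0 tlt)//.
by near: n; exact: near_crossing_time_le.
Unshelve. all: by end_near. Qed.

End weighted_supremum.

Theorem proposition1p5 (R : realType) (d : measure_display)
    (T : measurableType d) (P : probability T R) (N : R -> {RV P >-> nat})
    (gamma x : R) :
  standard_poisson_process N ->
  0 < gamma <= 1 ->
  (gamma = 1 -> 1 <= x ->
     measurable [set w | (weighted_sup N gamma w <= x%:E)%E] /\
     P [set w | (weighted_sup N gamma w <= x%:E)%E] = (1 - 1 / x)%:E) /\
  (gamma < 1 -> 0 < x ->
     [/\ measurable [set w | (weighted_sup N gamma w <= x%:E)%E],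
         cvgn (fun n => \sum_(1 <= k < n) a_coef x gamma k) &
         P [set w | (weighted_sup N gamma w <= x%:E)%E] =
         (1 - limn (fun n => \sum_(1 <= k < n) a_coef x gamma k))%:E]).
Proof.
move=> PN /andP[g0 _]; split=> [g1 x1|g1 x0].
  have x0 : 0 < x by rewrite (lt_le_trans _ x1).
  have mE := measurable_weighted_sup N PN x gamma x0 g0.
  split=> //; rewrite (prE P)//; congr _%:E; rewrite g1.
  move: x1; rewrite le_eqVlt => /predU1P[<-|x1].
    by rewrite pr_weighted_sup_linear1// divr1 subrr.
  exact: pr_weighted_sup_linear.
have mE := measurable_weighted_sup N PN x gamma x0 g0.
have t0 := crossing_time0 x gamma g0.
have tlt := crossing_time_lt x gamma x0 g0.
have sumE : (\sum_(1 <= k < n) a_coef x gamma k) @[n --> \oo] -->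
    1 - pr P [set w | (weighted_sup N gamma w <= x%:E)%E].
  rewrite -cvg_shiftS/=.
  apply: (@cvg_trans _ ((1 - pr P (avoid N (crossing_time x gamma) n)) @[n --> \oo])).
    apply: near_eq_cvg; apply: nearW => n.
    rewrite -(sum_pr_first_hit N _ n); apply: eq_big_nat => k /andP[k0 _].
    by rewrite (pr_first_hit_a_coef N PN).
  by apply: cvgB; [exact: cvg_cst|exact: cvg_pr_avoid].
split=> //; first by apply/cvg_ex; eexists; exact: sumE.
by rewrite (cvg_lim _ sumE)// subKr; exact: prE.
Qed.
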